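(* Let $P$ be the Petersen graph. Let $H$ be a connected graph such that $H\prec P$ (i.e. $P$ admits an $H$-colouring) and let $f$ be an $H$-colouring of $P$. Then either $H=H_f\simeq P$ or $H_f\simeq S_4$.
   Context: Graphs are finite, undirected and loopless, but may contain parallel edges; $\simeq$ denotes isomorphism of (multi)graphs. For a vertex $u$ of a graph $G$, $\partial_G u$ denotes the set of edges of $G$ incident to $u$. For graphs $G,H$, an $H$-colouring of $G$ is a map $f:E(G)\to E(H)$ that is a proper edge-colouring (adjacent edges of $G$ receive distinct edges of $H$) such that for every $u\in V(G)$ there exists $v\in V(H)$ with $f(\partial_G u)=\partial_H v$. We write $H\prec G$ ($H$ colours $G$) if $G$ admits an $H$-colouring. For an $H$-colouring $f$ of $G$, $H_f$ denotes the subgraph $H[\mathrm{Im}(f)]$ of $H$ induced by the edge set $\mathrm{Im}(f)$ (its edges are those in $\mathrm{Im}(f)$, its vertices are the endvertices of these edges). $S_4$ is the multigraph on four vertices $u,v,w,z$ with exactly the following five edges: two parallel edges between $v$ and $w$, one edge $uv$, one edge $uw$, and one edge $uz$ (so $u,v,w$ have degree $3$ and $z$ has degree $1$). *)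

(* Defs.v *)
From mathcomp Require Import all_boot.
Set Implicit Arguments.
Unset Strict Implicit.
Unset Printing Implicit Defensive.

(* Finite loopless multigraphs: distinct edges may have the same set of ends. *)
Record mgraph := MGraph {
  vertex : finType;
  edge : finType;
  ends : edge -> {set vertex};
  ends_card2 : forall e, #|ends e| = 2
}.

Arguments ends {m} e.

Definition incident (G : mgraph) (u : vertex G) : {set edge G} :=
  [set e | u \in ends e].

Definition adjacent_edges (G : mgraph) (e1 e2 : edge G) : bool :=
  (e1 != e2) && ~~ [disjoint ends e1 & ends e2].

Definition vadj (G : mgraph) : rel (vertex G) :=
  fun x y => [exists e : edge G, ends e == [set x; y]].

(* The empty graph is not connected. *)
Definition connected_graph (G : mgraph) : Prop :=
  0 < #|vertex G| /\ forall x y : vertex G, connect (@vadj G) x y.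

Definition isomorphic (G H : mgraph) : Prop :=
  exists (phi : vertex G -> vertex H) (psi : edge G -> edge H),
    [/\ bijective phi, bijective psi
      & forall e, ends (psi e) = phi @: ends e].

Definition is_colouring (H G : mgraph) (f : edge G -> edge H) : Prop :=
  (forall e1 e2, adjacent_edges e1 e2 -> f e1 != f e2) /\
  (forall u : vertex G, exists v : vertex H, f @: incident u = incident v).

Definition colours (H G : mgraph) : Prop :=
  exists f : edge G -> edge H, is_colouring f.

Record subgraph (H : mgraph) := Subgraph {
  sub_vertices : {set vertex H};
  sub_edges : {set edge H};
  sub_closed : [forall e in sub_edges, ends e \subset sub_vertices]
}.

Section SubgraphAsGraph.

Variables (H : mgraph) (K : subgraph H).

Definition sub_vertex := {v : vertex H | v \in sub_vertices K}.
Definition sub_edge := {e : edge H | e \in sub_edges K}.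

Definition sub_ends (e : sub_edge) : {set sub_vertex} :=
  [set v | val v \in ends (val e)].

Lemma sub_ends_card2 e : #|sub_ends e| = 2.
Proof.
rewrite -(ends_card2 (val e)) -(card_imset _ val_inj); apply: eq_card => x.
apply/imsetP/idP => [[v] | xe]; first by rewrite inE => ? ->.
have /subsetP/(_ x xe) xK := forall_inP (sub_closed K) (val e) (valP e).
by exists (Sub x xK); rewrite ?inE.
Qed.

Definition mgraph_of_subgraph : mgraph := MGraph sub_ends_card2.

End SubgraphAsGraph.

Coercion mgraph_of_subgraph : subgraph >-> mgraph.

Lemma whole_closed (H : mgraph) :
  [forall e in [set: edge H], ends e \subset [set: vertex H]].
Proof. by apply/forall_inP => e _; exact: subsetT. Qed.

Definition whole (H : mgraph) : subgraph H := Subgraph (whole_closed H).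

Lemma edge_induced_closed (H : mgraph) (F : {set edge H}) :
  [forall e in F, ends e \subset \bigcup_(e' in F) ends e'].
Proof. by apply/forall_inP => e eF; exact: bigcup_sup. Qed.

Definition edge_induced (H : mgraph) (F : {set edge H}) : subgraph H :=
  Subgraph (edge_induced_closed F).

Definition colour_image (H G : mgraph) (f : edge G -> edge H) : subgraph H :=
  edge_induced [set f e | e : edge G].

(* The Petersen graph as the Kneser graph K(5,2): vertices are the 2-subsets of
   a 5-set, and edges are the (unordered) pairs of disjoint 2-subsets. *)
Definition petersen_vertex := {A : {set 'I_5} | #|A| == 2}.

Definition petersen_edge :=
  {X : {set petersen_vertex} |
    (#|X| == 2) && [forall A in X, forall B in X,
                      (A != B) ==> [disjoint val A & val B]]}.

Lemma petersen_ends_card2 (X : petersen_edge) : #|val X| = 2.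
Proof. by case/andP: (valP X) => /eqP. Qed.

Definition Petersen : mgraph := MGraph petersen_ends_card2.

(* S_4: the vertices u, v, w, z are 0, 1, 2, 3; edges 0 and 1 are the parallel
   edges vw, and edges 2, 3, 4 are uv, uw, uz. *)
Definition S4_u : 'I_4 := @Ordinal 4 0 isT.
Definition S4_v : 'I_4 := @Ordinal 4 1 isT.
Definition S4_w : 'I_4 := @Ordinal 4 2 isT.
Definition S4_z : 'I_4 := @Ordinal 4 3 isT.

Definition S4_ends (e : 'I_5) : {set 'I_4} :=
  match val e with
  | 0 | 1 => [set S4_v; S4_w]
  | 2 => [set S4_u; S4_v]
  | 3 => [set S4_u; S4_w]
  | _ => [set S4_u; S4_z]
  end.

Lemma S4_ends_card2 e : #|S4_ends e| = 2.
Proof. by rewrite /S4_ends; case: (val e) => [|[|[|[|?]]]]; rewrite cards2. Qed.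

Definition S4 : mgraph := MGraph S4_ends_card2.

(* Main.v *)
Require Import Defs.
From mathcomp Require Import all_boot.

(* An edge of H has only two ends, so each colour occurs in at most two distinct
   colour triples f(∂u). Up to renaming colours, a backtracking search shows
   that the proper edge-colourings of the Petersen graph with this property are
   the injective one and 120 colourings with five colours a, b, c, d, e and
   triples abc, abd, cde. In the second case these triples are the edges at three
   vertices of H, which force the ends of the five edges up to the far end of e:
   this is S_4. In the first case f embeds the Petersen graph in H with the same
   vertex degrees, so by connectedness the copy is all of H. *)

(** * Backtracking search over numbered colourings of the Petersen graph *)

Definition vertex_pairs : seq (nat * nat) :=
  [:: (0, 1); (0, 2); (0, 3); (0, 4); (1, 2); (1, 3); (1, 4); (2, 3); (2, 4);
      (3, 4)].

(* Edges are indices into this list of pairs of vertex indices; its order was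
   tuned to keep the search tree of [check_extensions] small. *)
Definition edge_pairs : seq (nat * nat) :=
  [:: (1, 9); (0, 9); (4, 9); (0, 8); (0, 7); (1, 5); (1, 6); (6, 7); (2, 6);
      (3, 7); (3, 5); (5, 8); (3, 4); (2, 8); (2, 4)].

Definition stars : seq (seq nat) := Eval vm_compute in
  [seq [seq j <- iota 0 15 | let e := nth (0, 0) edge_pairs j in
                             (i == e.1) || (i == e.2)] | i <- iota 0 10].

(** Sorting makes vertices with the same colours give equal lists, so that [undup] counts distinct
    triples. *)
Definition star_colours (s st : seq nat) : seq nat :=
  sort leq [seq nth 0 s j | j <- st].

(* [s] colours the first [size s] edges. An edge of [H] has two ends, so it lies
   in at most two sets [incident v]: this is all that is remembered of [H]. *)
Definition admissible (s : seq nat) : bool :=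
  if all (fun st => uniq [seq nth 0 s j | j <- st & j < size s]) stars then
    let ts := undup [seq star_colours s st |
                     st <- stars & all (fun j => j < size s) st] in
    all (fun c => size [seq t <- ts | c \in t] <= 2) (undup s)
  else false.

(* [c] lists the colours in the order of the edges of [S4]; the three triples are
   the edges at v, w and u. *)
Definition S4_pattern (s : seq nat) : bool :=
  let ts := [seq star_colours s st | st <- stars] in
  has (fun c => all (fun t => sort leq [seq nth 0 c k | k <- t] \in ts)
                  [:: [:: 0; 1; 2]; [:: 0; 1; 3]; [:: 2; 3; 4]])
      (permutations (undup s)).

(* [if] rather than [||]: under [vm_compute] the latter would enumerate the 15!
   permutations of an injective colouring. *)
Definition injective_or_S4 (s : seq nat) : bool :=
  if uniq s then true
  else if size (undup s) == 5 then S4_pattern s else false.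

Fixpoint check_extensions (n : nat) (s : seq nat) : bool :=
  if admissible s then
    if n is n'.+1 then
      all (fun c => check_extensions n' (rcons s c)) (rcons (undup s) (size s))
    else injective_or_S4 s
  else true.

Lemma check_all : check_extensions 15 [::].
Proof. by vm_compute. Qed.

(** * Soundness of the search and canonical naming of colours *)

(** The induction follows the single branch of the search tree that spells [p]: no prefix of [p] is
    pruned, and each next entry is among the colours tried. *)
Lemma check_extensions_sound (p : seq nat) (n k : nat) :
    (forall i, admissible (take i p)) ->
    (forall i, i < size p -> nth 0 p i \in rcons (undup (take i p)) i) ->
    size p = k + n -> check_extensions n (take k p) ->
  injective_or_S4 p.
Proof.
move=> adm first; elim: n k => [|n IHn] k size_p /=; rewrite adm.
  by rewrite take_oversize // size_p addn0.
have lt_k : k < size p by rewrite size_p addnS ltnS leq_addr.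
move/allP/(_ (nth 0 p k)); rewrite size_takel ?(ltnW lt_k) // -take_nth //.
by move=> /(_ (first _ lt_k)); apply: IHn; rewrite size_p addSnnS.
Qed.

Lemma enumeration_sound (p : seq nat) : size p = 15 ->
    (forall i, admissible (take i p)) ->
    (forall i, i < 15 -> nth 0 p i \in rcons (undup (take i p)) i) ->
  injective_or_S4 p.
Proof.
move=> size_p adm first.
apply: (check_extensions_sound p 15 0 adm); rewrite ?size_p ?take0.
- exact: first.
- exact: erefl.
- exact: check_all.
Qed.

(** Cutting [p] down to a prefix only removes constraints: the coloured part of a star is a
    subsequence of it, and complete triples of the prefix are triples of [p]. *)
Lemma admissible_take (p : seq nat) (k : nat) : size p = 15 ->
    all (fun st => uniq [seq nth 0 p j | j <- st]) stars ->
    (forall c, size [seq t <- undup [seq star_colours p st | st <- stars]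
                    | c \in t] <= 2) ->
  admissible (take k p).
Proof.
move=> size_p proper two.
have nthp j : j < size (take k p) -> nth 0 (take k p) j = nth 0 p j.
  by move=> lt_j; rewrite nth_take // (leq_trans lt_j) // size_take_min geq_minl.
rewrite /admissible ifT; last first.
  apply/allP => st /(allP proper); apply: subseq_uniq.
  rewrite (iffLR (eq_in_map _ (nth 0 p) _)) ?map_subseq ?filter_subseq // => j.
  by rewrite mem_filter => /andP[/nthp].
apply/allP => c _; apply: leq_trans (two c).
apply: uniq_leq_size; first by rewrite filter_uniq ?undup_uniq.
move=> t; rewrite !mem_filter !mem_undup => /andP[-> /mapP[st]].
rewrite mem_filter => /andP[/allP lt_st st_in ->]; apply/mapP; exists st => //.
by congr sort; apply/eq_in_map => j /lt_st/nthp.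
Qed.

(* Renames each colour to the index of its first occurrence, so that the colour of
   edge [k] is either an earlier one or [k]: the only choices explored by
   [check_extensions]. *)
Definition first_index {T : eqType} (s : seq T) : seq nat :=
  [seq index c s | c <- s].

Lemma nth_first_index (T : eqType) (x0 : T) (s : seq T) (j : nat) :
  j < size s -> nth 0 (first_index s) j = index (nth x0 s j) s.
Proof. exact: nth_map. Qed.

Lemma first_index_new_or_old (T : eqType) (s : seq T) (k : nat) :
    k < size s ->
  nth 0 (first_index s) k \in rcons (undup (take k (first_index s))) k.
Proof.
case: s => [//|x0 s']; set s := x0 :: s' => lt_k.
rewrite (nth_first_index _ x0) // mem_rcons inE mem_undup -map_take.
have [old|new] := boolP (nth x0 s k \in take k s).
    by rewrite (map_f (index^~ s) old) orbT.
(* A new colour has index exactly [k]: it is absent from the prefix of length [k] but present in the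
   next one. *)
rewrite eqn_leq [k <= _]leqNgt -(in_take_leq _ (ltnW lt_k)) new andbT.
by rewrite -ltnS -in_take_leq // (take_nth x0) // mem_rcons mem_head.
Qed.

(** * Numbering of the vertices and edges of the Petersen graph *)

(** The default [(0, 1)] is a genuine pair, so that [pvertex] is total on numbers. *)
Definition pair_set (i : nat) : {set 'I_5} :=
  let ab := nth (0, 1) vertex_pairs i in
  [set k : 'I_5 | (val k == ab.1) || (val k == ab.2)].

Lemma card_pair_set (i : nat) : #|pair_set i| == 2.
Proof.
have ltI5 : all (fun ab => ab.1 < ab.2 < 5) vertex_pairs by [].
rewrite /pair_set; set ab := nth _ _ i.
have /andP[lt_ab lt_b5] : ab.1 < ab.2 < 5.
  by rewrite /ab; case: (ltnP i 10) => [/(all_nthP (0, 1) ltI5)|le_i];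
    last by rewrite nth_default.
have := cards2 (Ordinal (ltn_trans lt_ab lt_b5)) (Ordinal lt_b5).
rewrite -val_eqE /= (ltn_eqF lt_ab) => card2.
apply/eqP; rewrite -[RHS]card2; apply: eq_card => k; by rewrite !inE -!val_eqE.
Qed.

Definition pvertex (i : nat) : petersen_vertex :=
  Sub (pair_set i) (card_pair_set i).

Lemma pvertex_surj (x : petersen_vertex) : exists2 i, i < 10 & x = pvertex i.
Proof.
suff [i lt_i xi] : exists2 i, i < 10 & val x = pair_set i.
  by exists i => //; apply: val_inj.
case: x => A /= /cards2P[a [b [neq_ab ->]]] {A}.
(* The table lists each pair in increasing order. *)
exists (index (minn a b, maxn a b) vertex_pairs).
  by case: a b neq_ab => [[|[|[|[|[|//]]]]] lta] [[|[|[|[|[|//]]]]] ltb].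
apply/setP => k; rewrite /pair_set !inE -!val_eqE.
case: a b neq_ab => [[|[|[|[|[|//]]]]] lta] [[|[|[|[|[|//]]]]] ltb] //= _;
  by rewrite // orbC.
Qed.

(** Membership and disjointness on plain numbers, so that finite checks on the tables hold by
    evaluation. *)
Definition in_pair (i k : nat) : bool :=
  let ab := nth (0, 1) vertex_pairs i in (k == ab.1) || (k == ab.2).

Definition disjoint_pairs (i i' : nat) : bool :=
  all (fun k => ~~ (in_pair i k && in_pair i' k)) (iota 0 5).

Lemma disjoint_pair_set (i i' : nat) :
  [disjoint pair_set i & pair_set i'] = disjoint_pairs i i'.
Proof.
rewrite disjoint_subset; apply/subsetP/allP => [dis k | dis k].
  rewrite mem_iota => /= lt_k; have := dis (Ordinal lt_k).
  by rewrite !inE negb_and -implybE => /implyP.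
have := dis (val k); rewrite mem_iota ltn_ord !inE negb_and -implybE.
by move=> /(_ isT)/implyP.
Qed.

Lemma pvertex_inj (i i' : nat) : i < 10 -> i' < 10 ->
  pvertex i = pvertex i' -> i = i'.
Proof.
have sep : all (fun i => all (fun i' =>
    has (fun k => in_pair i k != in_pair i' k) (iota 0 5) || (i == i'))
  (iota 0 10)) (iota 0 10) by [].
move=> lt_i lt_i' /(congr1 val) eq_ii'.
have /(allP sep) : i \in iota 0 10 by rewrite mem_iota.
move=> /allP/(_ i'); rewrite mem_iota => /(_ lt_i')/orP[|/eqP//].
case/hasP => k; rewrite mem_iota => /= lt_k.
have /setP/(_ (Ordinal lt_k)) : pair_set i = pair_set i' by [].
by rewrite !inE /in_pair => -> /eqP.
Qed.

(** The default [(1, 9)] is an actual edge, which makes [pedge] total as well. *)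
Definition edge_ends (j : nat) : nat * nat := nth (1, 9) edge_pairs j.

Lemma edge_endsP (j : nat) :
  [/\ (edge_ends j).1 < 10, (edge_ends j).2 < 10,
      (edge_ends j).1 != (edge_ends j).2
    & disjoint_pairs (edge_ends j).1 (edge_ends j).2].
Proof.
have ok : all (fun e => [&& e.1 < 10, e.2 < 10, e.1 != e.2
                          & disjoint_pairs e.1 e.2]) edge_pairs by [].
apply/and4P; rewrite /edge_ends.
case: (ltnP j 15) => [/(all_nthP (1, 9) ok)//|le_j].
by rewrite nth_default.
Qed.

Lemma pedge_subproof (j : nat) :
  let X := [set pvertex (edge_ends j).1; pvertex (edge_ends j).2] in
  (#|X| == 2) && [forall A in X, forall B in X,
                    (A != B) ==> [disjoint val A & val B]].
Proof.
cbv zeta; have [lt1 lt2 neq12 dis] := edge_endsP j.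
rewrite cards2 (contra_neq (@pvertex_inj _ _ lt1 lt2)) //=.
move: dis; rewrite -disjoint_pair_set => /= dis.
apply/forall_inP => A /set2P[]->; apply/forall_inP => B /set2P[]->;
  by rewrite ?eqxx //= ?[[disjoint pair_set (edge_ends j).2 & _]]disjoint_sym
             dis implybT.
Qed.

Definition pedge (j : nat) : petersen_edge :=
  exist _ [set pvertex (edge_ends j).1; pvertex (edge_ends j).2] (pedge_subproof j).

Lemma pedge_surj (e : petersen_edge) : exists2 j, j < 15 & e = pedge j.
Proof.
(* The table of edges misses no pair of disjoint 2-subsets, in one order or the other. *)
have complete : all (fun i => all (fun i' => disjoint_pairs i i' ==>
    has (fun j => (edge_ends j == (i, i')) || (edge_ends j == (i', i)))
    (iota 0 15)) (iota 0 10)) (iota 0 10) by [].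
case: e => X PX; have /andP[/cards2P[x [y [neq_xy defX]]] /forall_inP disX] := PX.
have [i lt_i def_x] := pvertex_surj x; have [i' lt_i' def_y] := pvertex_surj y.
have [xX yX] : x \in X /\ y \in X by rewrite defX set21 set22.
have := forall_inP (disX x xX) y yX.
rewrite neq_xy def_x def_y disjoint_pair_set => /= dis.
have /(allP complete)/allP/(_ i') : i \in iota 0 10 by rewrite mem_iota.
rewrite mem_iota dis => /(_ lt_i')/hasP[j]; rewrite mem_iota => lt_j def_j.
exists j => //; apply: val_inj; rewrite /= defX def_x def_y.
by case/orP: def_j => /eqP-> //; rewrite setUC.
Qed.

Definition star (i : nat) : seq nat := nth [::] stars i.

Lemma mem_star (i j : nat) : i < 10 -> j < 15 ->
  (j \in star i) = (pvertex i \in val (pedge j)).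
Proof.
have ok : all (fun i => all (fun j =>
    (j \in star i) == ((i == (edge_ends j).1) || (i == (edge_ends j).2)))
  (iota 0 15)) (iota 0 10) by [].
move=> lt_i lt_j; have [lt1 lt2 _ _] := edge_endsP j.
rewrite !inE !(inj_in_eq (D := gtn 10) pvertex_inj) //.
have /(allP ok)/allP/(_ j) : i \in iota 0 10 by rewrite mem_iota.
by rewrite mem_iota => /(_ lt_j)/eqP.
Qed.

(** * Identifying edge-induced subgraphs up to isomorphism *)

(** The isomorphism is the inverse of the embedding. An edge-induced subgraph has no isolated
    vertex, whence the covering condition on [G]. *)
Lemma isomorphic_edge_induced (G H : mgraph) (F : {set edge H})
    (phi : vertex G -> vertex H) (psi : edge G -> edge H) :
    injective phi -> injective psi -> F = [set psi e | e : edge G] ->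
    (forall e, ends (psi e) = phi @: ends e) ->
    (forall x, exists e, x \in @ends G e) ->
  isomorphic (edge_induced F) G.
Proof.
move=> phi_inj psi_inj defF ends_psi cover.
have F_codom e : e \in F -> e \in codom psi.
  by rewrite defF => /imsetP[e' _ ->]; exact: codom_f.
have FE (e : sub_edge (edge_induced F)) : val e \in codom psi.
  exact: F_codom (valP e).
have EF e : psi e \in F by rewrite defF imset_f.
have FV (x : sub_vertex (edge_induced F)) : val x \in codom phi.
  have /bigcupP[_ /F_codom/codomP[e ->]] := valP x.
  by rewrite ends_psi => /imsetP[y _ ->]; exact: codom_f.
have VF x : phi x \in \bigcup_(e in F) ends e.
  have [e xe] := cover x; apply/bigcupP; exists (psi e) => //.
  by rewrite ends_psi imset_f.
exists (fun x => iinv (FV x)), (fun e => iinv (FE e)); split.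
- exists (fun x => Sub (phi x) (VF x)) => x;
    last by apply: phi_inj; rewrite f_iinv.
  by apply: val_inj; rewrite /= f_iinv.
- exists (fun e => Sub (psi e) (EF e)) => e;
    last by apply: psi_inj; rewrite f_iinv.
  by apply: val_inj; rewrite /= f_iinv.
have mem_ends x e :
    (iinv (FV x) \in ends (iinv (FE e))) = (val x \in ends (val e)).
  by rewrite -(mem_imset _ _ phi_inj) -ends_psi !f_iinv.
move=> e; apply/setP => x; apply/idP/imsetP => [xe | [y ye ->]].
  exists (Sub (phi x) (VF x)); last by apply: phi_inj; rewrite f_iinv.
  by rewrite inE -mem_ends (phi_inj (iinv _) x) ?f_iinv.
by rewrite mem_ends; move: ye; rewrite inE.
Qed.

Lemma ends_eq (H : mgraph) (e : edge H) (x y : vertex H) :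
  x != y -> x \in ends e -> y \in ends e -> ends e = [set x; y].
Proof.
move=> neq_xy xe ye; apply/esym/eqP; rewrite eqEcard ends_card2 cards2 neq_xy.
by rewrite subUset !sub1set xe ye.
Qed.

(** Each of [d0] to [d3] lies in two of the three stars, which gives both its ends. The far end [z]
    of [d4] is neither [v] nor [w], since [d4] is in neither star. *)
Lemma isomorphic_S4 (H : mgraph) (d0 d1 d2 d3 d4 : edge H) (u v w : vertex H) :
    uniq [:: d0; d1; d2; d3; d4] ->
    incident v =i [:: d0; d1; d2] -> incident w =i [:: d0; d1; d3] ->
    incident u =i [:: d2; d3; d4] ->
  isomorphic (edge_induced [set d in [:: d0; d1; d2; d3; d4]]) S4.
Proof.
move=> d_uniq inc_v inc_w inc_u.
have ve e : (v \in ends e) = (e \in [:: d0; d1; d2]) by rewrite -inc_v inE.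
have we e : (w \in ends e) = (e \in [:: d0; d1; d3]) by rewrite -inc_w inE.
have ue e : (u \in ends e) = (e \in [:: d2; d3; d4]) by rewrite -inc_u inE.
have [z def_z] : exists z, ends d4 = [set u; z].
  have /cards2P[x [y [neq_xy defd]]] : #|ends d4| == 2 by rewrite ends_card2.
  have := ue d4; rewrite defd !inE eqxx !orbT => /orP[]/eqP->.
    by exists y.
  by exists x; rewrite setUC.
have z4 : z \in ends d4 by rewrite def_z set22.
move: (d_uniq); rewrite /= !inE !negb_or -!andbA.
case/and5P=> n01 n02 n03 n04 /and5P[n12 n13 n14 n23 /and3P[n24 n34 _]].
have ne := (negbTE n02, negbTE n03, negbTE n04, negbTE n12, negbTE n13,
            negbTE n14, negbTE n23, negbTE n24, negbTE n34).
(* Vertices are told apart by an edge incident to exactly one of them. *)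
have sep (x y : vertex H) (e : edge H) :
  (x \in ends e) != (y \in ends e) -> x != y by apply: contraNneq => ->.
have neq_vw : v != w.
  by apply: (sep _ _ d3); rewrite ve we !inE ![d3 == _]eq_sym eqxx !ne.
have neq_uv : u != v by apply: (sep _ _ d0); rewrite ue ve !inE eqxx !ne.
have neq_uw : u != w by apply: (sep _ _ d0); rewrite ue we !inE eqxx !ne.
have neq_vz : v != z.
  by apply: (sep _ _ d4); rewrite z4 ve !inE ![d4 == _]eq_sym !ne.
have neq_wz : w != z.
  by apply: (sep _ _ d4); rewrite z4 we !inE ![d4 == _]eq_sym !ne.
have neq_uz : u != z.
  by apply/eqP => eq_uz; have := ends_card2 d4; rewrite def_z eq_uz cards2 eqxx.
apply: (@isomorphic_edge_induced S4 H _
  (fun x : 'I_4 => nth u [:: u; v; w; z] x)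
  (fun e : 'I_5 => nth d0 [:: d0; d1; d2; d3; d4] e)).
- have uniq4 : uniq [:: u; v; w; z].
    by rewrite /= !inE !negb_or neq_uv neq_uw neq_uz neq_vw neq_vz neq_wz.
  by move=> x y /eqP; rewrite nth_uniq // => /eqP/val_inj.
- by move=> x y /eqP; rewrite nth_uniq // => /eqP/val_inj.
- apply/setP => e; rewrite inE; apply/idP/imsetP => [/(nthP d0)[k lt_k <-] | [k _ ->]].
    by exists (Ordinal lt_k).
  by apply: mem_nth; case: k.
- case=> [[|[|[|[|[|//]]]]] lt_e] /=; rewrite /S4_ends /= imsetU1 imset_set1 /=.
  + by apply: ends_eq; rewrite ?ve ?we ?inE ?eqxx ?orbT.
  + by apply: ends_eq; rewrite ?ve ?we ?inE ?eqxx ?orbT.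
  + by apply: ends_eq; rewrite ?ve ?ue ?inE ?eqxx ?orbT.
  + by apply: ends_eq; rewrite ?ue ?we ?inE ?eqxx ?orbT.
  + by [].
have cover : [forall x : 'I_4, exists e : 'I_5, x \in S4_ends e].
  apply/forallP.
  case=> [[|[|[|[|//]]]] lt_x]; apply/existsP.
  + by exists (@Ordinal 5 4 isT); rewrite !inE.
  + by exists (@Ordinal 5 0 isT); rewrite !inE.
  + by exists (@Ordinal 5 0 isT); rewrite !inE.
  + by exists (@Ordinal 5 4 isT); rewrite !inE.
by move=> x; apply/existsP; have/forallP := cover.
Qed.

Lemma subgraph_eq (H : mgraph) (K L : subgraph H) :
  sub_vertices K = sub_vertices L -> sub_edges K = sub_edges L -> K = L.
Proof.
case: K L => [VK EK cK] [VL EL cL] /= eqV eqE; move: cK cL.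
by rewrite eqV eqE => cK cL; congr Subgraph; apply: bool_irrelevance.
Qed.

(** * Incidence in the Petersen graph read off the table of stars *)

Lemma star_lt (i j : nat) : j \in star i -> j < 15.
Proof.
have ok : all (all (gtn 15)) stars by [].
rewrite /star; case: (ltnP i 10) => [/(all_nthP [::] ok)/allP|le_i]; first exact.
by rewrite nth_default.
Qed.

Lemma mem_incident_pvertex (i j : nat) : i < 10 -> j < 15 ->
  (pedge j \in @incident Petersen (pvertex i)) = (j \in star i).
Proof. by move=> lt_i lt_j; rewrite mem_star // inE. Qed.

Lemma imset_incident_pvertex (T : finType) (f : petersen_edge -> T) (i : nat) :
    i < 10 ->
  f @: @incident Petersen (pvertex i) =i [seq f (pedge j) | j <- star i].
Proof.
move=> lt_i x; apply/imsetP/mapP => [[e] | [j j_st ->]].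
  by have [j lt_j ->] := pedge_surj e; rewrite mem_incident_pvertex //; exists j.
by exists (pedge j); rewrite // mem_incident_pvertex ?(star_lt _ _ j_st).
Qed.

Lemma petersen_incident_inj : injective (@incident Petersen).
Proof.
have sep : all (fun i => all (fun i' =>
    has (fun j => (j \in star i) != (j \in star i')) (iota 0 15) || (i == i'))
  (iota 0 10)) (iota 0 10) by [].
move=> x y; have [i lt_i ->] := pvertex_surj x.
have [i' lt_i' ->] := pvertex_surj y; move/setP => eq_inc.
have /(allP sep)/allP/(_ i') : i \in iota 0 10 by rewrite mem_iota.
rewrite mem_iota => /(_ lt_i')/orP[/hasP[j]|/eqP-> //].
rewrite mem_iota => lt_j; have := eq_inc (pedge j).
by rewrite !mem_incident_pvertex // => -> /eqP.
Qed.

Lemma pedge_inj (j j' : nat) : j < 15 -> j' < 15 -> pedge j = pedge j' -> j = j'.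
Proof.
have sep : all (fun j => all (fun j' =>
    has (fun i => (j \in star i) != (j' \in star i)) (iota 0 10) || (j == j'))
  (iota 0 15)) (iota 0 15) by [].
move=> lt_j lt_j' eq_jj'.
have /(allP sep)/allP/(_ j') : j \in iota 0 15 by rewrite mem_iota.
rewrite mem_iota => /(_ lt_j')/orP[/hasP[i]|/eqP//].
by rewrite mem_iota => lt_i; rewrite !mem_star // eq_jj' eqxx.
Qed.

Lemma petersen_covered (x : vertex Petersen) : exists e, x \in ends e.
Proof.
have ok : all (fun i => has (mem (star i)) (iota 0 15)) (iota 0 10) by [].
have [i lt_i ->] := pvertex_surj x.
have /(allP ok)/hasP[j] : i \in iota 0 10 by rewrite mem_iota.
rewrite mem_iota => lt_j j_st; exists (pedge j : edge Petersen).
by rewrite -mem_star.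
Qed.

(** * From a colouring by [H] to the search and back *)

Definition petersen_colours {T : Type} (f : petersen_edge -> T) : seq T :=
  [seq f (pedge j) | j <- iota 0 15].

Section Colouring.

Variables (H : mgraph) (f : edge Petersen -> edge H).
Hypothesis f_col : is_colouring f.

(** [s] holds the actual colours, [p] their canonical numbers, and [col] turns a number back into an
    edge of [H]. *)
Let s := petersen_colours f.
Let p := first_index s.
Let col c := nth (f (pedge 0)) s c.

Lemma nth_petersen_colours j : j < 15 -> col j = f (pedge j).
Proof. by move=> lt_j; rewrite /col (nth_map 0) ?size_iota // nth_iota. Qed.

Lemma petersen_colours_surj e : f e \in s.
Proof.
by have [j lt_j ->] := pedge_surj e; apply: map_f; rewrite mem_iota.
Qed.

Lemma col_index e : col (index (f e) s) = f e.
Proof. exact/nth_index/petersen_colours_surj. Qed.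

Lemma nth_canonical j : j < 15 -> nth 0 p j = index (f (pedge j)) s.
Proof.
move=> lt_j; rewrite (nth_first_index _ (f (pedge 0))) ?size_map //.
by rewrite -(nth_petersen_colours _ lt_j).
Qed.

Lemma map_nth_canonical i :
  [seq nth 0 p j | j <- star i] = [seq index (f (pedge j)) s | j <- star i].
Proof. by apply/eq_in_map => j /star_lt; apply: nth_canonical. Qed.

Lemma canonical_proper :
  all (fun st => uniq [seq nth 0 p j | j <- st]) stars.
Proof.
have star_uniq : all uniq stars by [].
apply/(all_nthP [::]) => i lt_i; rewrite -/(star i).
rewrite map_inj_in_uniq ?(all_nthP _ star_uniq) // => j j' j_st j'_st.
have [lt_j lt_j'] := (star_lt _ _ j_st, star_lt _ _ j'_st).
rewrite !nth_canonical // => /(congr1 col); rewrite !col_index.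
apply: contra_eq => neq_jj'; apply: (proj1 f_col).
apply/andP; split; first exact: contra_neq (@pedge_inj _ _ lt_j lt_j') neq_jj'.
by apply/pred0Pn; exists (pvertex i); rewrite /= -!mem_star ?j_st.
Qed.

(** A triple containing [c] is sent to a vertex of [H] having it as its star. This vertex is an end
    of [col c] and determines the triple, so there are at most two. *)
Lemma canonical_two_triples c :
  size [seq t <- undup [seq star_colours p st | st <- stars] | c \in t] <= 2.
Proof.
have [v def_v] := fin_all_exists (proj2 f_col).
(* Several vertices of the Petersen graph may carry the same triple; [row] chooses the first. *)
pose row t := find (fun st => star_colours p st == t) stars.
have rowP t : t \in [seq star_colours p st | st <- stars] ->
    row t < 10 /\ t = sort leq [seq index (f (pedge j)) s | j <- star (row t)].
  case/mapP => st st_in def_t.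
  have has_t : has (fun st => star_colours p st == t) stars.
    by apply/hasP; exists st; rewrite // def_t.
  split; first by move: has_t; rewrite has_find.
  by rewrite -map_nth_canonical -[LHS](eqP (nth_find [::] has_t)).
set L := filter _ _.
have L_row t : t \in L -> [/\ c \in t, row t < 10 &
    t = sort leq [seq index (f (pedge j)) s | j <- star (row t)]].
  by rewrite mem_filter mem_undup => /andP[-> /rowP[]].
rewrite -(size_map (fun t => v (pvertex (row t)))) -(ends_card2 (col c)) cardE.
apply: uniq_leq_size => [|_ /mapP[t /L_row[c_t lt_t def_t] ->]]; last first.
  move: c_t; rewrite {1}def_t mem_sort mem_enum => /mapP[j j_st ->].
  rewrite col_index.
  have : f (pedge j) \in f @: @incident Petersen (pvertex (row t)).
    by rewrite imset_incident_pvertex // (map_f (fun j => f (pedge j))).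
  by rewrite def_v inE.
rewrite map_inj_in_uniq ?filter_uniq ?undup_uniq //.
move=> t t' /L_row[_ lt_t def_t] /L_row[_ lt_t' def_t'] eq_v.
(* Sorted lists agree once the unsorted ones, free of repetition, have the same elements. *)
rewrite def_t def_t'; apply/perm_sortP;
  [exact: leq_total | exact: leq_trans | exact: anti_leq |].
have row_uniq i : i < 10 -> uniq [seq index (f (pedge j)) s | j <- star i].
  move=> lt_i; rewrite -map_nth_canonical.
  exact: (all_nthP [::] canonical_proper).
apply: uniq_perm; rewrite ?row_uniq //.
rewrite !(map_comp (index^~ s) (fun j => f (pedge j))); apply: eq_mem_map => x.
by rewrite -!imset_incident_pvertex // !def_v eq_v.
Qed.

Lemma canonical_injective_or_S4 : injective_or_S4 p.
Proof.
have size_p : size p = 15 by rewrite !size_map.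
apply: enumeration_sound => [|k|k lt_k]; first exact: size_p.
  apply: admissible_take; first exact: size_p.
    exact: canonical_proper.
  exact: canonical_two_triples.
by apply: first_index_new_or_old; rewrite size_map size_iota.
Qed.

Lemma injective_colouring : uniq p -> injective f.
Proof.
move=> p_uniq e e'; have [j lt_j ->] := pedge_surj e.
have [j' lt_j' ->] := pedge_surj e'; move/(congr1 (index^~ s)).
rewrite -!nth_canonical // => /eqP; rewrite nth_uniq ?size_map ?size_iota //.
by move/eqP->.
Qed.

(** Each triple of the pattern is the image of a star, hence by [col] the full star of a vertex of
    [H]; the five colours together are the image of [f]. *)
Lemma S4_colouring : size (undup p) == 5 -> S4_pattern p ->
  isomorphic (colour_image f) S4.
Proof.
move=> size5 /hasP[c]; rewrite mem_permutations => perm_c.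
have colK : {in p, cancel col (index^~ s)}.
  by move=> _ /mapP[_ /mapP[j _ ->] ->]; rewrite col_index.
have mem_c : c =i p by move=> x; rewrite (perm_mem perm_c) mem_undup.
have d_uniq : uniq (map col c).
  rewrite map_inj_in_uniq ?(perm_uniq perm_c) ?undup_uniq //.
  by move=> x y; rewrite !mem_c; apply: (can_in_inj colK).
have mem_d : map col c =i s.
  move=> x; rewrite (eq_mem_map _ mem_c) -map_comp.
  apply/idP/idP => [/mapP[_ /mapP[j _ ->] ->] | /mapP[j j_in ->]].
    by rewrite /= col_index petersen_colours_surj.
  apply/mapP; exists (f (pedge j)); rewrite /= ?col_index //.
  exact: petersen_colours_surj.
have triple t :
    sort leq t \in [seq star_colours p st | st <- stars] ->
  exists v : vertex H, incident v =i map col t.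
  case/(nthP [::])=> i; rewrite size_map => lt_i.
  rewrite (nth_map [::]) // -/(star i) => eq_t.
  have [v def_v] := proj2 f_col (pvertex i); exists v => x.
  rewrite -def_v imset_incident_pvertex //.
  have mem_t : t =i [seq index (f (pedge j)) s | j <- star i].
    by move=> y; rewrite -(mem_sort leq) -eq_t mem_sort map_nth_canonical.
  rewrite (eq_mem_map _ mem_t) -map_comp; congr (x \in _).
  by apply/eq_map => j; rewrite /= col_index.
have -> : colour_image f = edge_induced [set d in map col c].
  congr edge_induced; apply/setP => x; rewrite inE mem_d.
  apply/imsetP/idP => [[e _ ->] | /mapP[j _ ->]]; first exact: petersen_colours_surj.
  by exists (pedge j).
case: c perm_c d_uniq {mem_c mem_d} => [|c0 [|c1 [|c2 [|c3 [|c4 [|c5 c]]]]]] /perm_size;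
  rewrite (eqP size5) // => _ d_uniq.
case/and4P=> /triple[v inc_v] /triple[w inc_w] /triple[u inc_u] _.
exact: isomorphic_S4 d_uniq inc_v inc_w inc_u.
Qed.

(** Choosing for each vertex [x] some [v x] whose star is the image of that of [x] makes [v] and [f]
    an embedding; it is onto because [H] is connected. *)
Lemma petersen_colouring : connected_graph H -> injective f ->
  whole H = colour_image f /\ isomorphic (colour_image f) Petersen.
Proof.
move=> [_ H_conn] f_inj; have [v def_v] := fin_all_exists (proj2 f_col).
have v_inj : injective v.
  move=> x y eq_v; apply: petersen_incident_inj; apply: (imset_inj f_inj).
  by rewrite !def_v eq_v.
have v_end x e : x \in ends e -> v x \in ends (f e).
  move=> xe; have : f e \in f @: incident x by rewrite imset_f ?inE.
  by rewrite def_v inE.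
have ends_f e : ends (f e) = v @: ends e.
  apply/esym/eqP; rewrite eqEcard card_imset // !ends_card2 andbT.
  by apply/subsetP => _ /imsetP[x xe ->]; apply: v_end.
split; last first.
  exact: isomorphic_edge_induced v_inj f_inj erefl ends_f petersen_covered.
(* Every edge of [H] at some [v a] is a colour, so its other end is again a value of [v]. *)
have closed_v : closed (@vadj H) (codom v).
  apply: intro_closed => [|x y /existsP[e /eqP def_e] /codomP[a def_a]].
    by apply: sym_connect_sym => x y; apply: eq_existsb => e; rewrite setUC.
  have : e \in incident (v a) by rewrite inE def_e def_a set21.
  rewrite -def_v => /imsetP[e' _ def_e'].
  have : y \in v @: ends e' by rewrite -ends_f -def_e' def_e set22.
  by case/imsetP=> b _ ->; apply: codom_f.
have v_surj y : y \in codom v.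
  pose x0 : vertex Petersen := pvertex 0.
  by rewrite -(closed_connect closed_v (H_conn (v x0) y)) codom_f.
have f_surj d : d \in f @: [set: edge Petersen].
  have /card_gt0P[y yd] : 0 < #|ends d| by rewrite ends_card2.
  have /codomP[x def_y] := v_surj y.
  have : d \in f @: incident x by rewrite def_v inE -def_y.
  by case/imsetP=> e _ ->; rewrite imset_f.
apply: subgraph_eq; apply/setP => x; rewrite inE; apply/esym; last first.
  by have /imsetP[e _ ->] := f_surj x; rewrite imset_f.
have /codomP[y ->] := v_surj x; have [e ye] := petersen_covered y.
by apply/bigcupP; exists (f e); rewrite ?imset_f ?v_end.
Qed.

End Colouring.

Theorem theorem3p3 (H : mgraph) (H_connected : connected_graph H)
    (H_colours_P : colours H Petersen)
    (f : edge Petersen -> edge H) (f_colouring : is_colouring f) :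
  (whole H = colour_image f /\ isomorphic (colour_image f) Petersen) \/
  isomorphic (colour_image f) S4.
Proof.
have := canonical_injective_or_S4 _ _ f_colouring; rewrite /injective_or_S4.
case: ifP => [/(injective_colouring _ f) f_inj _ | _].
  by left; apply: petersen_colouring.
by case: ifP => // size5 /(S4_colouring _ _ f_colouring size5); right.
Qed.
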